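(* Let $u=24+5\sqrt{23}$ and, for every integer $k\ge 0$, let $T_k,S_k\in\mathbb Z$ be defined by $T_k+S_k\sqrt{23}=(1+\sqrt{23})\,u^k$. Put $\mathcal A=\{k\in\mathbb Z_{\ge 0}: k\equiv 15 \ \text{or}\ 440 \pmod{575}\}$, and for $k\in\mathcal A$ let $$c_k=\frac{S_k^2-1}{5},\qquad x_k=\frac{c_k-120}{575}.$$ For every $k\in\mathcal A$ we have $x_k\notin\{-1,0,d_-,d_+\}$, where $d_\pm$ are the regular extension values of the Diophantine triple $\{a,b,c\}=\{5,115,c_k\}$, that is, $$d_{\pm}=a+b+c+2abc\pm 2\sqrt{(ab+1)(ac+1)(bc+1)}\quad\text{with } a=5,\ b=115,\ c=c_k .$$ Consequently, both of the following assertions are false: (i) (the assertion asked about in Dujella's Problem 4.8) for every Diophantine triple $\{a,b,c\}$ and every integral point $(x,y)$ with $x\neq -1$ on $y^2=(ax+1)(bx+1)(cx+1)$, the integers $ax+1$, $bx+1$, $cx+1$ are all perfect squares; (ii) (Dujella's Conjecture 1.4.5) for every Diophantine triple $\{a,b,c\}$, the only $x$-coordinates of integral points on $y^2=(ax+1)(bx+1)(cx+1)$ are $0$, $d_-$, $d_+$, together with $-1$ when $1\in\{a,b,c\}$, where $d_{\pm}=a+b+c+2abc\pm 2\sqrt{(ab+1)(ac+1)(bc+1)}$.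
   Context: A set $\{a,b,c\}$ of three distinct positive integers is called a Diophantine triple if $ab+1$, $ac+1$ and $bc+1$ are all perfect squares. An integral point on a curve is a point both of whose coordinates are integers. For $k\in\mathcal A$, the set $\{5,115,c_k\}$ is a Diophantine triple. *)

(* Defs.v *)
From Stdlib Require Import Reals ZArith Lra Lia.

Local Open Scope Z_scope.

Definition is_square (n : Z) : Prop := exists r : Z, n = r * r.

Definition diophantine_triple (a b c : Z) : Prop :=
  (0 < a /\ 0 < b /\ 0 < c) /\
  (a <> b /\ a <> c /\ b <> c) /\
  (is_square (a * b + 1) /\ is_square (a * c + 1) /\ is_square (b * c + 1)).

Definition integral_point (a b c x y : Z) : Prop :=
  y * y = (a * x + 1) * (b * x + 1) * (c * x + 1).

Local Open Scope R_scope.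

Definition d_minus (a b c : R) : R :=
  a + b + c + 2 * a * b * c - 2 * sqrt ((a * b + 1) * (a * c + 1) * (b * c + 1)).

Definition d_plus (a b c : R) : R :=
  a + b + c + 2 * a * b * c + 2 * sqrt ((a * b + 1) * (a * c + 1) * (b * c + 1)).

Definition u : R := 24 + 5 * sqrt 23.

Definition coefficients (T S : nat -> Z) : Prop :=
  forall k : nat, IZR (T k) + IZR (S k) * sqrt 23 = (1 + sqrt 23) * u ^ k.

(** Such integer sequences exist; they are unique since [sqrt 23] is
    irrational, so quantifying over them universally loses nothing. *)
Lemma coefficients_exist : exists T S : nat -> Z, coefficients T S.
Proof.
pose (step := fun p : Z * Z =>
  (24 * fst p + 115 * snd p, 5 * fst p + 24 * snd p)%Z).
pose (p := fun k => Nat.iter k step (1%Z, 1%Z)).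
exists (fun k => fst (p k)), (fun k => snd (p k)); intros k.
assert (H23 : sqrt 23 * sqrt 23 = 23) by (apply sqrt_sqrt; lra).
induction k as [|k IH]; [simpl; ring|].
change (p (S k)) with (step (p k)); unfold step; cbn [fst snd pow].
rewrite !plus_IZR, !mult_IZR.
replace ((1 + sqrt 23) * (u * u ^ k)) with (u * ((1 + sqrt 23) * u ^ k)) by ring.
rewrite <- IH; unfold u.
set (s := sqrt 23) in *.
transitivity (24 * IZR (fst (p k)) + 5 * IZR (snd (p k)) * (s * s)
  + (5 * IZR (fst (p k)) + 24 * IZR (snd (p k))) * s); [rewrite H23|]; ring.
Qed.

Definition index_set (k : nat) : Prop :=
  (Z.of_nat k mod 575 = 15 \/ Z.of_nat k mod 575 = 440)%Z.

(** Divisions are exact divisions in [R], with no rounding. *)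
Definition c_of (s : Z) : R := (IZR s ^ 2 - 1) / 5.
Definition x_of (c : R) : R := (c - 120) / 575.

Local Open Scope Z_scope.

Definition problem_4_8 : Prop :=
  forall a b c x y : Z,
    diophantine_triple a b c ->
    integral_point a b c x y ->
    x <> -1 ->
    is_square (a * x + 1) /\ is_square (b * x + 1) /\ is_square (c * x + 1).

Definition conjecture_1_4_5 : Prop :=
  forall a b c x y : Z,
    diophantine_triple a b c ->
    integral_point a b c x y ->
    x = 0 \/
    IZR x = d_minus (IZR a) (IZR b) (IZR c) \/
    IZR x = d_plus (IZR a) (IZR b) (IZR c) \/
    (x = -1 /\ (a = 1 \/ b = 1 \/ c = 1)).

(* Main.v *)
Require Import Defs.
From Stdlib Require Import Reals ZArith Lra Lia.

(** The counterexamples rest on one identity: if [c = a + b + a b x], then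
    [(a x + 1) (b x + 1) = c x + 1], so that
    [(a x + 1) (b x + 1) (c x + 1) = (c x + 1) ^ 2] and [(x, c x + 1)] is a
    point of the curve attached to [{a, b, c}].  For [a = 5] and [b = 115] the
    relation reads [c = 120 + 575 x], which is exactly [x = x_k] for [c = c_k].

    The point is not regular.  The values [d_-] and [d_+] are the two roots [d]
    of [(a + b - c - d)^2 = 4 (a b + 1) (c d + 1)].  Substituting
    [c = a + b + a b d] turns this into
    [(1 - 3 a b) d^2 = 4 + 4 (a + b) d], which has no positive solution when
    [a] and [b] are positive with [a b >= 1] ([regular_value_neq]).  It remains to see that [x_k > 0], which
    holds for all [k >= 1] because [S_k >= 29] there; this excludes [-1] and [0]
    as well.

    The factor [b x + 1] is not a square when [c] is large.  If [a c + 1 = S^2]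
    and [b x + 1 = m^2], then [S^2 - (a m)^2 = a b + 1], while two distinct
    squares, the larger one being [S^2], differ by at least [2 S - 1]
    ([factor_not_square]).

    To use these facts the sequences must be identified.  Since [sqrt 23] is
    irrational, the equations defining [T_k] and [S_k] force the recurrence
    given by multiplication by [24 + 5 sqrt 23] ([coefficients_orbit]).  Both
    assertions are then refuted by the term [k = 15], where [x_15] is an integer:
    [T^2 - 23 S^2] keeps its initial value [-22], so [5 c + 1 = S^2] yields
    [115 c + 1 = T^2], and [5 * 115 + 1 = 24^2]. *)

Local Open Scope Z_scope.

(** Descent: modulo 4 the equation reads [p^2 + q^2 = 0], so both [p] and [q]
    are even and can be halved. *)
Lemma square_eq_23_square (p q : Z) : p * p = 23 * (q * q) -> q = 0.
Proof.
  revert p.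
  induction q as [q IH] using (well_founded_induction
    (well_founded_ltof Z Z.abs_nat)).
  intros p Hpq.
  destruct (Z.eq_dec q 0) as [|Hq]; [assumption|exfalso].
  destruct (Z.Even_or_Odd p) as [[p' ->]|[p' ->]];
    destruct (Z.Even_or_Odd q) as [[q' ->]|[q' ->]]; try lia.
  assert (q' = 0); [|lia].
  apply (IH q') with (p := p'); [unfold ltof|]; lia.
Qed.

Lemma sqrt23_coordinates_unique (p q p' q' : Z) :
  (IZR p + IZR q * sqrt 23 = IZR p' + IZR q' * sqrt 23)%R ->
  p = p' /\ q = q'.
Proof.
  intros H.
  assert (H23 : (sqrt 23 * sqrt 23 = 23)%R) by (apply sqrt_sqrt; lra).
  assert (Hd : (IZR (p - p') = IZR (q' - q) * sqrt 23)%R)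
    by (rewrite !minus_IZR; lra).
  assert (Hq : q' - q = 0).
  { apply (square_eq_23_square (p - p')), eq_IZR.
    rewrite !(mult_IZR (p - p')), mult_IZR, (mult_IZR (q' - q)), Hd.
    transitivity (IZR (q' - q) * IZR (q' - q) * (sqrt 23 * sqrt 23))%R;
      [|rewrite H23]; ring. }
  rewrite Hq, Rmult_0_l in Hd; apply eq_IZR_R0 in Hd; lia.
Qed.

(** Multiplication by [24 + 5 sqrt 23] in the coordinates [1], [sqrt 23]. *)
Definition step (p : Z * Z) : Z * Z :=
  (24 * fst p + 115 * snd p, 5 * fst p + 24 * snd p).

Definition orbit (k : nat) : Z * Z := Nat.iter k step (1, 1).

Lemma coefficients_orbit (T S : nat -> Z) :
  coefficients T S -> forall k, (T k, S k) = orbit k.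
Proof.
  intros HTS k.
  assert (H23 : (sqrt 23 * sqrt 23 = 23)%R) by (apply sqrt_sqrt; lra).
  induction k as [|k IH].
  - destruct (sqrt23_coordinates_unique (T 0%nat) (S 0%nat) 1 1) as [-> ->];
      [|reflexivity].
    rewrite (HTS 0%nat); simpl; ring.
  - change (orbit (Datatypes.S k)) with (step (orbit k)); rewrite <- IH.
    unfold step; cbn [fst snd].
    destruct (sqrt23_coordinates_unique (T (Datatypes.S k)) (S (Datatypes.S k))
      (24 * T k + 115 * S k) (5 * T k + 24 * S k)) as [-> ->]; [|reflexivity].
    rewrite (HTS (Datatypes.S k)), !plus_IZR, !mult_IZR; cbn [pow].
    replace ((1 + sqrt 23) * (u * u ^ k))%R
      with (u * ((1 + sqrt 23) * u ^ k))%R by ring.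
    rewrite <- (HTS k); unfold u.
    set (s := sqrt 23) in *.
    replace 115%R with (5 * (s * s))%R by (rewrite H23; ring).
    ring.
Qed.

Lemma orbit_pos (k : nat) : 1 <= fst (orbit k) /\ 1 <= snd (orbit k).
Proof.
  induction k as [|k IH]; [simpl; lia|].
  change (orbit (S k)) with (step (orbit k)); unfold step; cbn [fst snd]; lia.
Qed.

(** The bound only has to exceed [sqrt 601], the value of [S] at which
    [c = 120]. *)
Lemma orbit_succ_ge (k : nat) : 29 <= snd (orbit (S k)).
Proof.
  pose proof (orbit_pos k).
  change (orbit (S k)) with (step (orbit k)); unfold step; cbn [snd]; lia.
Qed.

Lemma integral_point_of_sum (a b x : Z) :
  integral_point a b (a + b + a * b * x) x ((a + b + a * b * x) * x + 1).
Proof. unfold integral_point; ring. Qed.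

(** A square [S^2] exceeds every smaller square by at least [2 S - 1], and
    [a c + 1 = (a b + 1) + a^2 (b x + 1)]. *)
Lemma factor_not_square (a b x S : Z) :
  0 < a * b + 1 < 2 * S - 1 ->
  a * (a + b + a * b * x) + 1 = S * S ->
  ~ is_square (b * x + 1).
Proof.
  intros Hab HS [m Hm].
  assert (H : S * S - (a * m) * (a * m) = a * b + 1)
    by (replace ((a * m) * (a * m)) with (a * a * (m * m)) by ring;
        rewrite <- HS, <- Hm; ring).
  assert (Z.abs (a * m) * Z.abs (a * m) = (a * m) * (a * m))
    by apply Z.abs_square.
  set (n := Z.abs (a * m)) in *.
  assert (0 <= n) by apply Z.abs_nonneg.
  assert (n <= S - 1) by nia.
  nia.
Qed.

Lemma regular_value_neq (a b x : R) :
  (0 < a -> 0 < b -> 1 <= a * b -> 0 < x ->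
   x <> d_minus a b (a + b + a * b * x) /\
   x <> d_plus a b (a + b + a * b * x))%R.
Proof.
  intros Ha Hb Hab Hx.
  set (c := (a + b + a * b * x)%R).
  assert (Habx : (0 < a * b * x)%R) by (apply Rmult_lt_0_compat; lra).
  assert (Hc : (0 < c)%R) by (unfold c; lra).
  set (D := ((a * b + 1) * (a * c + 1) * (b * c + 1))%R).
  assert (HD : (sqrt D * sqrt D = D)%R).
  { apply sqrt_sqrt; unfold D.
    repeat apply Rmult_le_pos; nra. }
  (* Squaring removes the sign that distinguishes the two regular values. *)
  assert (Hkey :
    ((x - (a + b + c + 2 * a * b * c)) * (x - (a + b + c + 2 * a * b * c))
       = 4 * D)%R -> False).
  { intros HE.
    assert (HE' : ((a * b + 1) *
      (4 + 4 * (a + b) * x + (3 * (a * b) - 1) * (x * x)) = 0)%R)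
      by (unfold D, c in HE; lra).
    assert (0 < a * b + 1)%R by lra.
    assert (0 <= (a + b) * x)%R by (apply Rmult_le_pos; lra).
    assert (0 <= (3 * (a * b) - 1) * (x * x))%R
      by (apply Rmult_le_pos; nra).
    apply Rmult_integral in HE'; lra. }
  unfold d_minus, d_plus; fold D.
  split; intros HE; apply Hkey.
  - replace (x - (a + b + c + 2 * a * b * c))%R with (- 2 * sqrt D)%R by lra.
    transitivity (4 * (sqrt D * sqrt D))%R; [ring|rewrite HD; ring].
  - replace (x - (a + b + c + 2 * a * b * c))%R with (2 * sqrt D)%R by lra.
    transitivity (4 * (sqrt D * sqrt D))%R; [ring|rewrite HD; ring].
Qed.

(** The term [k = 15] of the orbit: there [S^2] is congruent to [601] modulo
    [5 * 575], which makes [x] an integer.  The bound [289 < S] is what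
    [factor_not_square] asks for: [5 * 115 + 1 < 2 S - 1]. *)
Lemma counterexample_exists : exists x S : Z,
  0 < x /\ 289 < S /\ 5 * (5 + 115 + 5 * 115 * x) + 1 = S * S /\
  diophantine_triple 5 115 (5 + 115 + 5 * 115 * x).
Proof.
  set (T := fst (orbit 15)); set (S := snd (orbit 15)).
  vm_compute in T, S.
  exists ((S * S - 601) / 2875), S.
  repeat split; try (vm_compute; congruence).
  - exists 24; reflexivity.
  - exists S; reflexivity.
  - exists T; reflexivity.
Qed.

Local Open Scope R_scope.

Theorem corollary3p2 :
  (forall T S : nat -> Z, coefficients T S ->
   forall k : nat, index_set k ->
     let c := c_of (S k) in
     let x := x_of c in
     ~ (x = -1 \/ x = 0 \/ x = d_minus 5 115 c \/ x = d_plus 5 115 c))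
  /\ ~ problem_4_8
  /\ ~ conjecture_1_4_5.
Proof.
  destruct counterexample_exists as (x0 & S0 & Hx0 & HS0 & HSS0 & Htriple).
  split; [|split].
  - intros T S HTS k Hk c x.
    destruct k as [|k]; [destruct Hk as [Hk|Hk]; discriminate Hk|].
    assert (HS : (29 <= S (Datatypes.S k))%Z).
    { change (S (Datatypes.S k))
        with (snd (T (Datatypes.S k), S (Datatypes.S k))).
      rewrite (coefficients_orbit T S HTS); apply orbit_succ_ge. }
    apply IZR_le in HS.
    assert (Hx : 0 < x) by (unfold x, x_of, c, c_of; nra).
    assert (Hc : c = 5 + 115 + 5 * 115 * x) by (unfold x, x_of; lra).
    destruct (regular_value_neq 5 115 x) as [Hminus Hplus]; try lra.
    rewrite <- Hc in Hminus, Hplus.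
    intros [H|[H|[H|H]]]; (contradiction || lra).
  - intros H.
    destruct (H _ _ _ _ _ Htriple (integral_point_of_sum 5 115 x0))
      as (_ & Hsq & _); [lia|].
    revert Hsq; apply (factor_not_square 5 115 x0 S0); lia.
  - intros H.
    assert (Hx0R : 0 < IZR x0) by (apply IZR_lt; exact Hx0).
    destruct (regular_value_neq 5 115 (IZR x0)) as [Hminus Hplus]; try lra.
    specialize (H _ _ _ _ _ Htriple (integral_point_of_sum 5 115 x0)).
    rewrite !plus_IZR, !mult_IZR in H.
    destruct H as [H|[H|[H|[H _]]]]; (contradiction || lia).
Qed.
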